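(* Let $\mathbb{F}_q$ be a finite field of characteristic different from $2$. The set of monic irreducible polynomials having coefficients in $\mathbb{F}_q$ which can be written as a nonempty composition of monic degree $2$ polynomials (with coefficients in $\mathbb{F}_q$) can be partitioned into a finite disjoint union $\bigsqcup_{a\in\mathbb{F}_q}\mathcal{L}_a$ in such a way that each $\mathcal{L}_a$ is in natural bijection with the words of a regular language $\mathcal{L}$, which is independent of $a$. In particular, the set of such irreducible polynomials has a finite regular expression in terms of the elementary operations $\cup,\cdot,{}^*$.
   Context: For an alphabet (set of symbols) $\Sigma$, $\Sigma^*$ denotes the set of finite words over $\Sigma$, i.e. the free monoid generated by $\Sigma$, and a language is a subset of $\Sigma^*$. The operation $\cdot$ is concatenation of words, and for a language $\mathcal{L}$, $\mathcal{L}^*$ (Kleene star) is the smallest submonoid of $\Sigma^*$ containing $\mathcal{L}$. A language is regular if it is finite or can be expressed recursively starting from finite sets using the operations $\cup,\cdot,{}^*$; equivalently, if it is accepted by a deterministic finite automaton. When the alphabet is a set of polynomials, a word $f_1\cdots f_k$ corresponds to the composition $f_1\circ\cdots\circ f_k$. *)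

(* Defs.v *)
From mathcomp Require Import all_boot all_order all_algebra.
From mathcomp Require Import all_classical.

Set Implicit Arguments.
Unset Strict Implicit.
Unset Printing Implicit Defensive.

Import GRing.Theory.

Local Open Scope classical_set_scope.
Local Open Scope ring_scope.

(* The leaves are arbitrary finite languages, not just single letters. *)
Inductive regexp (A : Type) : Type :=
  | RFin of seq (seq A)
  | RUnion of regexp A & regexp A
  | RCat of regexp A & regexp A
  | RStar of regexp A.

Section Languages.
Variable A : eqType.
Implicit Types (L M : set (seq A)).

Definition lang_cat L M : set (seq A) := [set u ++ v | u in L & v in M].

Definition submonoid M : Prop :=
  M [::] /\ forall u v : seq A, M u -> M v -> M (u ++ v).

Definition lang_star L : set (seq A) := smallest submonoid L.

Fixpoint lang (e : regexp A) : set (seq A) :=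
  match e with
  | RFin s => [set w | w \in s]
  | RUnion e1 e2 => lang e1 `|` lang e2
  | RCat e1 e2 => lang_cat (lang e1) (lang e2)
  | RStar e1 => lang_star (lang e1)
  end.

Definition regular L : Prop := exists e : regexp A, L = lang e.

End Languages.

Section Compositions.
Variable F : fieldType.

Definition monic_quadratic : Type :=
  {f : {poly F} | (f \is monic) && (size f == 3%N)}.

(* The word f_1 ... f_k denotes f_1 \o ... \o f_k; the empty word denotes 'X. *)
Definition comp_word (w : seq monic_quadratic) : {poly F} :=
  foldr (fun (f : monic_quadratic) (g : {poly F}) => val f \Po g) 'X w.

Definition irr_comp : set {poly F} :=
  [set f | [/\ f \is monic, irreducible_poly f &
     exists2 w : seq monic_quadratic, w <> [::] & f = comp_word w]].

End Compositions.

Arguments irr_comp F : clear implicits.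

(* Main.v *)
(* Writing a letter as (X - b)^2 + c, the shift b can be absorbed into the
   constant term of the next letter, so every nonempty word equals w o (X - a)
   with all shifts of w zero; (w, a) is unique because f^2 + c = g^2 + d with f, g
   monic nonconstant forces f = g.  If G is monic irreducible of degree n over F_q,
   q odd, then G(X^2) is irreducible iff (-1)^n G(0) is not a square.  Applied to
   the prefixes of a word, this says that f_1 o ... o f_k is irreducible iff
   -c_1 and the values (f_1 o ... o f_(i-1))(c_i), 1 < i <= k, are nonsquares.
   Reading from left to right, it suffices to remember the function F_q -> F_q
   induced by the prefix, which takes finitely many values: the language is
   regular by Kleene's theorem. *)
Require Import Defs.
From mathcomp Require Import all_boot all_order all_algebra.
From mathcomp Require Import all_classical.
From mathcomp Require Import qpoly finfield qfpoly zify.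

Set Implicit Arguments.
Unset Strict Implicit.
Unset Printing Implicit Defensive.

Import GRing.Theory.

Local Open Scope classical_set_scope.
Local Open Scope ring_scope.

(** * Kleene's theorem: from finite automata to regular expressions *)

Section Kleene.
Variables (Q S : finType) (A : eqType) (letter : S -> A) (step : Q -> S -> Q).
Implicit Types (p q r : Q) (xs : seq Q) (w : seq S).

(* Words leading from p to r with all strictly intermediate states in xs. *)
Fixpoint path_regexp xs p r : regexp A :=
  if xs is k :: xs' then
    RUnion (path_regexp xs' p r)
      (RCat (path_regexp xs' p k)
        (RCat (RStar (path_regexp xs' k k)) (path_regexp xs' k r)))
  else RFin (nseq (p == r) [::]
             ++ [seq [:: letter s] | s <- enum S & step p s == r]).

Fixpoint inner_states xs p w : bool :=
  if w is s :: w' then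
    (w' == [::]) || (step p s \in xs) && inner_states xs (step p s) w'
  else true.

(** The cut is made at the first visit to [k]; the strict decrease in length lets later visits be
    treated by induction. *)
Lemma inner_states_split k xs p w : inner_states (k :: xs) p w ->
  inner_states xs p w \/
  exists u v, [/\ w = u ++ v, (size v < size w)%N, foldl step p u = k,
                  inner_states xs p u & inner_states (k :: xs) k v].
Proof.
elim: w p => [|s w IHw] p /=; first by left.
have [->|w0] /= := eqVneq w [::]; first by left.
rewrite inE => /andP[]; have [<- _ kw|nk /= qxs qw] := eqVneq (step p s) k.
  by right; exists [:: s], w; split.
case: (IHw _ qw) => [xw|[u [v [-> vw uk xu kv]]]]; first by left; rewrite qxs.
right; exists (s :: u), v; split => //=; first by rewrite ltnW.
by rewrite qxs xu orbT.
Qed.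

Lemma lang_star_cons (L : set (seq A)) u v :
  L u -> lang_star L v -> lang_star L (u ++ v).
Proof.
move=> Lu Lv M ML; case: (ML) => -[M0 MM] LM.
by apply: MM; [apply: LM|apply: Lv].
Qed.

Lemma lang_star_nil (L : set (seq A)) : lang_star L [::].
Proof. by move=> M [[]]. Qed.

Lemma path_regexp_sound xs p r v : lang (path_regexp xs p r) v ->
  exists2 w, v = map letter w & foldl step p w = r.
Proof.
elim: xs p r v => [|k xs IHxs] p r v /=.
  rewrite mem_cat => /orP[|/mapP[s]].
    by rewrite mem_nseq; case: eqP => //= -> /eqP ->; exists [::].
  by rewrite mem_filter => /andP[/eqP sr _] ->; exists [:: s].
case=> [/IHxs//|[_ /IHxs[w1 -> w1k]] [_ [v2 v2k [_ /IHxs[w3 -> w3r] <-]] <-]].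
have [w2 -> w2k] : exists2 w, v2 = map letter w & foldl step k w = k.
  (* Labels of loops at [k] form a submonoid, so the star, being the smallest one, stays inside
     it. *)
  apply: (v2k [set u | exists2 w, u = map letter w & foldl step k w = k]).
  split=> [|u /IHxs//]; split=> [|u1 u2 [x1 -> x1k] [x2 -> x2k]].
    by exists [::].
  by exists (x1 ++ x2); rewrite ?map_cat ?foldl_cat ?x1k.
by exists (w1 ++ w2 ++ w3); rewrite ?map_cat ?foldl_cat ?w1k ?w2k.
Qed.

Lemma path_regexp_complete xs p w :
  inner_states xs p w -> lang (path_regexp xs p (foldl step p w)) (map letter w).
Proof.
elim: xs p w => [|k xs IHxs] p w.
  case: w => [|s [|t w]] //= _; first by rewrite eqxx.
  rewrite mem_cat; apply/orP; right.
  by apply/mapP; exists s => //; rewrite mem_filter eqxx mem_enum.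
(* Induction on a bound for the length: each return to [k] peels off one factor of the star. *)
have loop : forall m v, (size v <= m)%N -> inner_states (k :: xs) k v ->
    lang (RCat (RStar (path_regexp xs k k)) (path_regexp xs k (foldl step k v)))
      (map letter v).
  elim=> [|m IHm] v.
    rewrite leqn0 size_eq0 => /eqP -> _; exists [::]; first exact: lang_star_nil.
    by exists [::] => //; apply: (IHxs k [::]).
  move=> vm; case/inner_states_split=> [xv|[u [v' [vE v'v uk xu kv']]]].
    exists [::]; first exact: lang_star_nil.
    by exists (map letter v) => //; apply: IHxs.
  have [|x xS [y yR xy]] := IHm v' _ kv'.
    by rewrite -ltnS (leq_trans v'v vm).
  rewrite vE; exists (map letter u ++ x).
    by apply: lang_star_cons => //; rewrite -[in X in path_regexp _ _ X]uk; apply: IHxs.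
  by exists y; rewrite ?foldl_cat ?uk // -catA xy map_cat.
case/inner_states_split=> [xw|[u [v [-> _ uk xu kv]]]].
  by left; apply: IHxs.
right; exists (map letter u); first by rewrite -uk; apply: IHxs.
by exists (map letter v); [rewrite foldl_cat uk; apply: (loop (size v))|rewrite map_cat].
Qed.

Lemma lang_foldr_union (es : seq (regexp A)) v :
  lang (foldr (@RUnion A) (RFin [::]) es) v <-> has (fun e => `[< lang e v >]) es.
Proof.
elim: es => [|e es IH] /=; first by split.
split=> [[ev|/IH ->]|/orP[/asboolP|/IH]]; rewrite ?orbT //; [|by left|by right].
by apply/orP; left; apply/asboolP.
Qed.

(** The recursion makes [h] the run of an automaton started at [h [::]]; the language is the union,
    over accepting end states, of the path expressions with all states allowed in between. *)
Theorem regular_of_finite_state (h : seq S -> Q) (acc : pred Q) :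
  (forall w s, h (rcons w s) = step (h w) s) ->
  regular [set map letter w | w in [set w | acc (h w)]].
Proof.
move=> hS; have hE w : h w = foldl step (h [::]) w.
  by elim/last_ind: w => // w s IHw; rewrite hS IHw foldl_rcons.
exists (foldr (@RUnion A) (RFin [::])
  [seq path_regexp (enum Q) (h [::]) r | r <- enum Q & acc r]).
apply/seteqP; split=> v.
  case=> w /= accw <-; apply/lang_foldr_union; rewrite has_map; apply/hasP.
  exists (h w); first by rewrite mem_filter accw mem_enum.
  apply/asboolP; rewrite [in X in path_regexp _ _ X]hE; apply: path_regexp_complete.
  by elim: w (h [::]) {accw} => //= s w IHw p; rewrite mem_enum IHw orbT.
move=> /lang_foldr_union; rewrite has_map => /hasP[r].
rewrite mem_filter => /andP[accr _] /asboolP/path_regexp_sound[w -> wr].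
by exists w => //=; rewrite hE wr.
Qed.

End Kleene.

(** * Irreducibility under composition; a sufficient condition for G(X^2) *)

Section IrreduciblePoly.
Variable F : fieldType.
Implicit Types (f g p q u : {poly F}).

(** A divisor [u] of [p] yields the divisor [u \Po q] of [p \Po q], and composing with a nonconstant
    [q] scales degrees by a positive factor, so equality of degrees can be pulled back. *)
Lemma irreducible_comp_left p q :
  (1 < size q)%N -> irreducible_poly (p \Po q) -> irreducible_poly p.
Proof.
move=> q_gt1 [pq_gt1 irr].
have q1_gt0 : (0 < (size q).-1)%N by case: (size q) q_gt1 => [|[]].
have nz_p : p != 0.
  by apply: contraTneq pq_gt1 => ->; rewrite comp_poly0 size_poly0.
have sz u v : size (u \Po q) = size (v \Po q) -> (size u).-1 = (size v).-1.
  by move=> /(congr1 predn)/eqP; rewrite !size_comp_poly eqn_pmul2r // => /eqP.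
split=> [|u u_neq1 up].
  have := size_comp_poly p q; case: (size p) => [|[|//]] /=;
  by case: (size (p \Po q)) pq_gt1 => [|[]].
have nz_u : u != 0 by apply: contraNneq nz_p => u0; rewrite u0 dvd0p in up.
have upq : u \Po q %| p \Po q by apply: dvdp_comp_poly.
have uq_neq1 : size (u \Po q) != 1%N.
  apply: contra_neq u_neq1 => /(congr1 predn)/eqP; rewrite size_comp_poly muln_eq0.
  by rewrite (gtn_eqF q1_gt0) orbF (polySpred nz_u) /= => /eqP ->.
rewrite -dvdp_size_eqp // (polySpred nz_u) (polySpred nz_p); apply/eqP; congr _.+1.
exact/sz/eqp_size/irr.
Qed.

Lemma irreducible_comp_XsubC p a :
  irreducible_poly (p \Po ('X - a%:P)) <-> irreducible_poly p.
Proof.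
have shift (b : F) : (1 < size ('X - b%:P)%R)%N by rewrite size_XsubC.
split; first exact: irreducible_comp_left.
move=> irr; apply: (irreducible_comp_left (shift (- a))).
rewrite -comp_polyA rmorphN opprK comp_polyB comp_polyX comp_polyC.
by rewrite addrK comp_polyXr.
Qed.

(* The polynomial w is the norm of u from F[X] to F[X^2]. *)
Lemma norm_X2 u : exists w, w \Po 'X^2 = u * (u \Po - 'X).
Proof.
exists (even_poly u ^+ 2 - 'X * odd_poly u ^+ 2).
rewrite comp_polyB (comp_polyM 'X) comp_polyX !rmorphXn /= -[in RHS](poly_even_odd u).
rewrite comp_polyD comp_polyM -!comp_polyA comp_polyX comp_Xn_poly sqrrN.
by rewrite mulrN [RHS]mulrC -subr_sqr exprMn [_ * 'X^2]mulrC.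
Qed.

(** Otherwise a Bezout relation between [g] and [w], composed with X^2, would make [u] divide 1. *)
Lemma dvdp_norm_X2 g u w : irreducible_poly g -> size u != 1%N ->
  u %| g \Po 'X^2 -> w \Po 'X^2 = u * (u \Po - 'X) -> g %| w.
Proof.
move=> irr_g u_neq1 ug wE; apply: contraR u_neq1.
rewrite -irreducible_poly_coprime // => /Bezout_eq1_coprimepP[[a b] /= ab1].
have : u %| (a * g + b * w) \Po 'X^2.
  by rewrite comp_polyD !comp_polyM dvdp_add ?dvdp_mull // wE dvdp_mulr.
by rewrite ab1 comp_polyC dvdp1.
Qed.

(* A proper factor u of G(X^2) has degree n, and its norm u(X) u(-X) is a constant
   multiple of G(X^2); evaluating at 0 makes (-1)^n G(0) a square. *)
Lemma irreducible_comp_X2 g : g \is monic -> irreducible_poly g ->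
  (forall y, y ^+ 2 != (-1) ^+ (size g).-1 * g.[0]) ->
  irreducible_poly (g \Po 'X^2).
Proof.
move=> mon_g irr_g nsq; pose n := (size g).-1.
have n_gt0 : (0 < n)%N by rewrite /n; case: irr_g; case: (size g) => [|[]].
have nz_g := monic_neq0 mon_g.
have szX2 : size ('X^2 : {poly F}) = 3%N by rewrite size_polyXn.
have nz_H : g \Po 'X^2 != 0 by rewrite comp_poly_eq0 ?szX2.
have szH : (size (g \Po 'X^2)).-1 = (n * 2)%N by rewrite size_comp_poly szX2.
have szNX : size (- 'X : {poly F}) = 2%N by rewrite size_polyN size_polyX.
(* A nonconstant divisor of G(X^2) has degree at least n, because G divides its norm [w], whose
   degree is that of [u]. *)
have factor u : size u != 1%N -> u %| g \Po 'X^2 ->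
    exists2 w, w \Po 'X^2 = u * (u \Po - 'X) &
      [/\ g %| w, (size w).-1 = (size u).-1 & (n <= (size u).-1)%N].
  move=> u1 uH; have [w wE] := norm_X2 u; exists w => //.
  have gw := dvdp_norm_X2 irr_g u1 uH wE.
  have nz_u : u != 0 by apply: contraNneq nz_H => u0; rewrite u0 dvd0p in uH.
  have nz_uN : u \Po - 'X != 0 by rewrite comp_poly2_eq0.
  have nz_w : w != 0.
    rewrite -(@comp_poly_eq0 _ w 'X^2) ?szX2 // wE mulf_neq0 //.
  have sw : (size w).-1 = (size u).-1.
    have := congr1 (fun p : {poly F} => (size p).-1) wE.
    rewrite size_comp_poly szX2 size_mul // size_comp_poly2 //.
    rewrite [in RHS](polySpred nz_u) /= addnS /= addnn -muln2 => /eqP.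
    by rewrite eqn_pmul2r // => /eqP.
  split=> //; rewrite -sw -ltnS /n -!polySpred //; exact: dvdp_leq.
split=> [|u u1 uH].
  by rewrite (polySpred nz_H) szH ltnS muln_gt0 n_gt0.
have [v vE] := dvdpP _ _ uH.
have nz_u : u != 0 by apply: contraNneq nz_H => u0; rewrite u0 dvd0p in uH.
have nz_v : v != 0 by apply: contraNneq nz_H => v0; rewrite vE v0 mul0r.
have [v1|v1] := eqVneq (size v) 1%N.
  have [c nz_c vc] := size_poly1P _ (introT eqP v1).
  by rewrite vE vc mul_polyC eqp_sym eqp_scale.
have vH : v %| g \Po 'X^2 by rewrite vE dvdp_mulr.
have [_ _ [_ _ nv]] := factor v v1 vH.
have [w wE [gw sw nu]] := factor u u1 uH.
(* Both factors have degree at least n, and their degrees add up to 2n. *)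
have su : (size u).-1 = n.
  move: szH; rewrite vE size_mul // (polySpred nz_v) (polySpred nz_u) addSn addnS /=.
  by move: (size v).-1 (size u).-1 nv nu => a b; clear -n; clearbody n; lia.
have wk : w = lead_coef w *: g.
  have /eqp_eq : w %= g.
    rewrite eqp_sym -dvdp_size_eqp // (polySpred nz_g) (@polySpred _ w) ?sw ?su //.
    by rewrite -(@comp_poly_eq0 _ w 'X^2) ?szX2 // wE mulf_neq0 ?comp_poly2_eq0.
  by rewrite (monicP mon_g) scale1r.
have lw : lead_coef w = lead_coef u ^+ 2 * (-1) ^+ n.
  have := congr1 lead_coef wE; rewrite lead_coefM !lead_coef_comp ?szX2 ?szNX //.
  by rewrite lead_coefXn expr1n mulr1 lead_coefN lead_coefX su mulrA.
(* The excluded square root: [w] takes the value u(0)^2 at 0 and equals lc(u)^2 (-1)^n [g]. *)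
have /eqP[] := nsq (u.[0] / lead_coef u).
have := congr1 (horner^~ 0) wE.
rewrite hornerM !horner_comp hornerXn expr0n hornerN hornerX oppr0 -expr2 /=.
rewrite {1}wk lw hornerZ expr_div_n => <-.
by rewrite -[_ * _ * g.[0]]mulrA [LHS]mulrC mulKf // expf_neq0 ?lead_coef_eq0.
Qed.

End IrreduciblePoly.

(** * Frobenius conjugates of a root; the converse condition for G(X^2) *)

Section FrobeniusRoots.
Variables (F : finFieldType) (L : finFieldType) (iota : {rmorphism F -> L}).
Local Notation q := #|F|.

Lemma exprDn_card (x y : L) : (x + y) ^+ q = x ^+ q + y ^+ q.
Proof.
have [p pr_p pF] := finPcharP F.
apply: exprDn_pchar; rewrite (card_pprimeChar pF) pnatX pnatE //.
by rewrite (rmorph_pchar iota).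
Qed.

(** The q-th power map is additive and multiplicative on [L] and fixes the image of [F], hence the
    coefficients. *)
Lemma horner_map_card (f : {poly F}) (x : L) :
  (map_poly iota f).[x] ^+ q = (map_poly iota f).[x ^+ q].
Proof.
elim/poly_ind: f => [|f c IHf].
  by rewrite rmorph0 !horner0 expr0n -(prednK (ltnW (finNzRing_gt1 F))).
rewrite rmorphD rmorphM /= map_polyX map_polyC !hornerMXaddC exprDn_card exprMn.
by rewrite IHf -rmorphXn expf_card.
Qed.

Lemma horner_map_card_exp (f : {poly F}) (x : L) i :
  (map_poly iota f).[x] ^+ (q ^ i) = (map_poly iota f).[x ^+ (q ^ i)].
Proof.
by elim: i => [|i IHi]; rewrite ?expr1 // expnSr !exprM IHi horner_map_card.
Qed.

Lemma expr_card_inj i : injective (fun x : L => x ^+ (q ^ i)).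
Proof.
have q_gt0 : (0 < q)%N by apply: ltnW (finNzRing_gt1 F).
elim: i => [|i IHi] x y; first by rewrite !expr1.
rewrite expnSr !exprM => exy; apply: IHi; apply/eqP; rewrite -subr_eq0.
move/eqP: exy; rewrite -{1}[x ^+ (q ^ i)](subrK (y ^+ (q ^ i))) exprDn_card.
by rewrite -subr_eq0 addrK expf_eq0 q_gt0.
Qed.

End FrobeniusRoots.

(** Take [L] = F[X]/(H) and [x] the class of X. If the q^m-th power fixed [x], it would fix all of
    [L], and X^(q^m) - X would have more roots than its degree. *)
Lemma extension_root_conjugates (F : finFieldType) (H : {poly F}) : H \is monic ->
  irreducible_poly H -> exists (L : finFieldType) (iota : {rmorphism F -> L}) (x : L),
    [/\ root (map_poly iota H) x, x ^+ (#|F| ^ (size H).-1) = x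
      & forall m, (0 < m < (size H).-1)%N -> x ^+ (#|F| ^ m) != x].
Proof.
move=> mon irr; pose mi : monic_irreducible_poly H := (irr, mon).
pose L : finFieldType := {poly %/ H with mi}.
have cardL : #|L| = (#|F| ^ (size H).-1)%N := card_qfpoly mi.
pose iota : {rmorphism F -> L} := GRing.in_alg L.
pose x : L := qpolyX H; exists L, iota, x.
have evE (p : {poly F}) : (map_poly iota p).[x] = in_qpoly H p :> L.
  elim/poly_ind: p => [|p c IHp]; first by rewrite rmorph0 horner0 rmorph0.
  rewrite !rmorphD !rmorphM /= map_polyX map_polyC hornerMXaddC IHp; congr (_ + _).
  by rewrite -alg_polyC in_qpolyZ in_qpoly1.
split.
- rewrite rootE evE; apply/eqP/val_inj => /=.
  by rewrite (mk_monicE mi) Pdiv.RingMonic.rmodpp.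
- by rewrite -cardL expf_card.
move=> m /andP[m_gt0 mN]; apply/eqP => xm.
have fix_all (y : L) : y ^+ (#|F| ^ m) = y.
  have -> : y = (map_poly iota (val y)).[x].
    rewrite evE; apply/val_inj; rewrite /= Pdiv.CommonRing.rmodp_small //.
    exact: size_mk_monic.
  by rewrite horner_map_card_exp xm.
have q_gt1 := finNzRing_gt1 F.
have qm_gt1 : (1 < #|F| ^ m)%N by rewrite -{1}(expn0 #|F|) ltn_exp2l.
pose P : {poly L} := 'X^(#|F| ^ m) - 'X.
have sizeP : size P = (#|F| ^ m).+1.
  by rewrite size_polyDl size_polyXn // size_polyN size_polyX.
have /max_poly_roots : P != 0 by rewrite -size_poly_eq0 sizeP.
move=> /(_ (enum L)); rewrite sizeP -cardE cardL ltnS leq_exp2l // leqNgt mN.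
suff allP : all (root P) (enum L) by move=> /(_ allP (enum_uniq L)).
by apply/allP => y _; rewrite rootE !hornerE fix_all subrr.
Qed.

(* If H = G(X^2) were irreducible with root x, of degree 2n, then -x is a conjugate
   x^(q^i) of x, which forces i = n.  Then z = prod_(i < n) x^(q^i) satisfies
   z^q = -z and z^2 = (-1)^n G(0) = y^2, so z = y or z = -y lies in F and z = -z. *)
Lemma reducible_comp_X2 (F : finFieldType) (g : {poly F}) (y : F) :
  2%N \notin [pchar F] -> g \is monic ->
  y ^+ 2 = (-1) ^+ (size g).-1 * g.[0] -> ~ irreducible_poly (g \Po 'X^2).
Proof.
move=> char2 mon_g yE irrH; pose n := (size g).-1.
have monH : g \Po 'X^2 \is monic.
  by rewrite monicE lead_coef_comp ?size_polyXn // lead_coefXn expr1n mulr1.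
have sizeH : (size (g \Po 'X^2)).-1 = (n + n)%N.
  by rewrite size_comp_poly size_polyXn muln2 addnn.
have n_gt0 : (0 < n)%N.
  by case: irrH; case: (size _) sizeH => [|[|m]] //= mE _ _; lia.
have [L [iota [x [rx]]]] := extension_root_conjugates monH irrH.
rewrite sizeH; set q := #|F|; pose c i := x ^+ (q ^ i).
rewrite -[X in X = x]/(c (n + n)%N) => xN x_min.
have c0 : c 0%N = x by rewrite /c expr1.
have cD i j : c i ^+ (q ^ j) = c (i + j)%N by rewrite /c -exprM expnD.
have q_gt0 : (0 < q)%N := ltnW (finNzRing_gt1 F).
have nz_x : x != 0.
  have := x_min 1%N; rewrite (leq_add n_gt0 n_gt0) => /(_ isT).
  by apply: contraNneq => ->; rewrite expr0n expn_eq0 (gtn_eqF q_gt0).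
have two_neq0 : 2%:R != 0 :> L.
  by have := char2; rewrite -(fmorph_pchar iota) inE.
have c_neq0 i : c i != 0 by rewrite expf_neq0.
have cN i : (- x) ^+ (q ^ i) = - c i.
  have := horner_map_card_exp iota (- 'X) x i.
  by rewrite rmorphN /= map_polyX !hornerN !hornerX.
have c_inj i j : (i < j < n + n)%N -> c i != c j.
  move=> /andP[ij jN]; have := x_min (j - i)%N.
  rewrite subn_gt0 ij (leq_ltn_trans (leq_subr _ _) jN) => /(_ isT).
  rewrite -/(c (j - i)%N); apply: contraNneq => cij.
  by apply/eqP; apply: (@expr_card_inj F L iota i); rewrite cD subnK ?(ltnW ij) // -cij.
pose rs := [seq c i | i <- index_iota 0 (n + n)].
have uniq_rs : uniq rs.
  rewrite map_inj_in_uniq ?iota_uniq // => i j.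
  rewrite !mem_index_iota /= => iN jN cij; apply/eqP.
  have := c_inj i j; have := c_inj j i; rewrite cij eqxx iN jN !andbT.
  by case: ltngtP => // _ H1 H2; [have := H1 isT|have := H2 isT].
(* The 2n conjugates [c i] are distinct roots of a monic polynomial of degree 2n. *)
have HE : map_poly iota (g \Po 'X^2) = \prod_(z <- rs) ('X - z%:P).
  rewrite [LHS](@all_roots_prod_XsubC _ _ rs).
  - by rewrite lead_coef_map (monicP monH) rmorph1 scale1r.
  - rewrite size_map_poly size_map size_iota subn0 -sizeH.
    by rewrite -polySpred // monic_neq0.
  - apply/allP => _ /mapP[i _ ->].
    by rewrite /root -horner_map_card_exp (rootP rx) expr0n expn_eq0 (gtn_eqF q_gt0).
  - by rewrite uniq_rootsE.
have [i iN xi] : exists2 i, (i < n + n)%N & - x = c i.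
  have : root (map_poly iota (g \Po 'X^2)) (- x).
    move: rx; rewrite !map_comp_poly /= map_polyXn.
    by rewrite !root_comp !hornerXn sqrrN.
  by rewrite HE root_prod_XsubC => /mapP[i]; rewrite mem_index_iota => iN xi; exists i.
have cnE : c n = - x.
  have c2i : c (i + i)%N = x by rewrite -cD -xi cN -xi opprK.
  have i_gt0 : (0 < i)%N.
    rewrite lt0n; apply: contra_neq nz_x => i0; move: xi; rewrite i0 c0 => /eqP.
    by rewrite eq_sym -addr_eq0 -mulr2n -mulr_natl mulf_eq0 (negPf two_neq0) => /eqP.
  (* Since c(2i) = x with 0 < 2i < 4n and 2n is the least period, 2i = 2n. *)
  have [lt|gt|eq] := ltngtP (i + i)%N (n + n)%N.
  - by have := x_min _ (introT andP (conj (ltn_addr i i_gt0) lt)); rewrite -/(c _) c2i eqxx.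
  - have dE : (n + n + (i + i - (n + n)) = i + i)%N by rewrite subnKC // ltnW.
    have := cD (n + n)%N (i + i - (n + n))%N; rewrite dE c2i xN => xd.
    have := x_min (i + i - (n + n))%N; rewrite subn_gt0 gt xd eqxx => /(_ _)/negP[] //.
    by clear -iN; lia.
  - by rewrite xi; congr c; clear -eq; lia.
pose z := \prod_(i < n) c i.
have z_neq0 : z != 0 by apply/prodf_neq0.
(* Frobenius moves the indices in [z] up by one, replacing the factor c(0) = x by c(n) = -x. *)
have zq : z ^+ q = - z.
  apply: (mulfI nz_x); rewrite -prodrXl.
  have -> : \prod_(i < n) c i ^+ q = \prod_(i < n) c i.+1.
    by apply: eq_bigr => j _; rewrite -[q]expn1 cD addn1.
  have : \prod_(i < n.+1) c i = x * \prod_(i < n) c i.+1 by rewrite big_ord_recl c0.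
  by rewrite big_ord_recr /= cnE => <-; rewrite !mulrN mulrC.
have gz : iota ((-1) ^+ n * g.[0]) = z ^+ 2.
  have := congr1 (horner^~ 0) HE.
  rewrite -[X in _.[X] = _](rmorph0 iota) horner_map horner_comp hornerXn expr0n /=.
  rewrite horner_prod /rs big_map big_mkord.
  under eq_bigr do rewrite hornerXsubC sub0r.
  (* The second half of the conjugates is the negative of the first: c(n + i) = -c(i). *)
  rewrite big_split_ord /=.
  under [X in _ * X]eq_bigr do rewrite -cD cnE cN opprK.
  rewrite prodrN card_ord -mulrA -expr2 => g0.
  by rewrite rmorphM /= rmorph_sign g0 signrMK.
have [y' zy'] : exists y', z = iota y'.
  have : iota y ^+ 2 == z ^+ 2 by rewrite -rmorphXn yE gz.
  rewrite eqf_sqr => /orP[]/eqP zy; first by exists y.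
  by exists (- y); rewrite rmorphN zy opprK.
move: zq; rewrite zy' -rmorphXn expf_card -zy' => /eqP.
rewrite -addr_eq0 -mulr2n -mulr_natl mulf_eq0 (negPf two_neq0).
by rewrite (negPf z_neq0).
Qed.

(** * Uniqueness of completed squares; existence of nonsquares *)

Section SquareRoots.
Variable F : fieldType.
Hypothesis two_neq0 : 2%:R != 0 :> F.

(** The product (f - g)(f + g) is constant, while f + g keeps positive degree with leading
    coefficient 2; hence f - g = 0. *)
Lemma monic_sqrDC_inj (f g : {poly F}) (c d : F) :
  f \is monic -> g \is monic -> size f = size g -> (1 < size f)%N ->
  f ^+ 2 + c%:P = g ^+ 2 + d%:P -> f = g /\ c = d.
Proof.
move=> mf mg sfg f_gt1 fg; suff fgE : f = g.
  by split=> //; apply/polyC_inj; rewrite fgE in fg; apply: addrI fg.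
have cst : (f - g) * (f + g) = (d - c)%:P.
  by rewrite -subr_sqr polyCB; apply/eqP; rewrite subr_eq addrAC eq_sym subr_eq fg addrC.
have s_gt1 : (1 < size (f + g)%R)%N.
  apply: leq_trans f_gt1 _; rewrite leqNgt; apply/negP => small.
  have /eqP : (f + g)`_(size f).-1 = 0.
    by rewrite nth_default // -ltnS prednK // (leq_trans _ small).
  rewrite coefD {2}sfg -!lead_coefE (monicP mf) (monicP mg) -[1 + 1]/(2%:R).
  by rewrite (negPf two_neq0).
have nz_s : f + g != 0 by rewrite -size_poly_gt0 ltnW.
apply/eqP; rewrite -subr_eq0; apply: contraTT s_gt1 => nz_d.
rewrite -leqNgt; apply: leq_trans (size_polyC_leq1 (d - c)).
by rewrite -cst size_mul // (polySpred nz_d) leq_addl.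
Qed.

End SquareRoots.

(** If all elements were squares, a choice of roots would be injective, hence bijective with
    squaring as inverse; but squaring identifies 1 and -1. *)
Lemma exists_nonsquare (F : finFieldType) : 2%:R != 0 :> F ->
  exists c : F, forall y, y ^+ 2 != c.
Proof.
move=> two_neq0; apply/not_existsP => sq.
have /fin_all_exists[r rE] : forall c : F, exists y, y ^+ 2 = c.
  by move=> c; have /existsNP[y /negP/negPn/eqP] := sq c; exists y.
have [r' _ rK] : bijective r by apply: injF_bij => c d /(congr1 (fun y => y ^+ 2)); rewrite !rE.
have r'E y : r' y = y ^+ 2 by rewrite -[in RHS](rK y) rE.
have : r (r' (-1)) = r (r' 1) by rewrite !r'E sqrrN.
by rewrite !rK => /eqP; rewrite eq_sym -addr_eq0 -[1 + 1]/(2%:R) (negPf two_neq0).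
Qed.

(** * Words of quadratics, their normal forms and the automaton *)

Section Words.
Variable F : finFieldType.
Hypothesis charF : 2%N \notin [pchar F].
Implicit Types (a b c x y : F) (s : F * F) (u v w : seq (F * F)).

Let two_neq0 : 2%:R != 0 :> F.
Proof. by have := charF; rewrite inE. Qed.

(** Completed squares let the finite type [F * F] serve as alphabet: [s.1] is the critical point and
    [s.2] the value there. *)
Definition quad s : {poly F} := ('X - s.1%:P) ^+ 2 + s.2%:P.

Lemma size_quad s : size (quad s) = 3%N.
Proof.
by rewrite size_polyDl ?size_exp_XsubC // (leq_ltn_trans (size_polyC_leq1 _)).
Qed.

Lemma monic_quad s : quad s \is monic.
Proof.
rewrite monicE lead_coefDl ?size_exp_XsubC ?(leq_ltn_trans (size_polyC_leq1 _)) //.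
by rewrite lead_coef_exp lead_coefXsubC expr1n.
Qed.

Fact letter_subproof s : (quad s \is monic) && (size (quad s) == 3%N).
Proof. by rewrite monic_quad size_quad. Qed.

Definition letter s : monic_quadratic F := exist _ (quad s) (letter_subproof s).

Lemma letter_surj (f : monic_quadratic F) : exists s, f = letter s.
Proof.
case: f => f fP; pose b := - f`_1 / 2%:R; exists (b, f`_0 - b ^+ 2).
apply: val_inj => /=; have /andP[/monicP mf /eqP sf] := fP.
rewrite lead_coefE sf /= in mf.
apply/polyP => i; rewrite /quad /= sqrrB -rmorphXn /=.
rewrite !(coefD, coefN, coefMn, coefXn, coefMC, coefC, coefX).
case: i => [|[|[|i]]] /=; rewrite ?(mul0r, mulr0n, mulr1n, mul0rn, sub0r, subr0, oppr0, add0r, addr0, mf) //.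
- by rewrite addrC subrK.
- by rewrite !mul1r -mulr2n -mulr_natr divfK // opprK.
- by apply: nth_default; rewrite sf.
Qed.

Definition wcomp w : {poly F} := comp_word (map letter w).

Lemma wcomp_cons s w : wcomp (s :: w) = (wcomp w - s.1%:P) ^+ 2 + s.2%:P.
Proof.
by rewrite /wcomp /= comp_polyD rmorphXn /= comp_polyB comp_polyX !comp_polyC.
Qed.

Lemma wcomp_rcons w s : wcomp (rcons w s) = wcomp w \Po quad s.
Proof.
elim: w => [|t w IHw]; first by rewrite /wcomp /= comp_polyXr comp_polyX.
by rewrite rcons_cons /wcomp /= -!/(wcomp _) IHw comp_polyA.
Qed.

Lemma size_wcomp w : size (wcomp w) = (2 ^ size w).+1.
Proof.
elim/last_ind: w => [|w s IHw]; first by rewrite size_polyX.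
have := size_comp_poly (wcomp w) (quad s).
rewrite -wcomp_rcons IHw size_quad /= size_rcons expnSr => <-.
rewrite prednK // size_poly_gt0 wcomp_rcons comp_poly_eq0 ?size_quad //.
by rewrite -size_poly_eq0 IHw.
Qed.

Lemma monic_wcomp w : wcomp w \is monic.
Proof.
elim/last_ind: w => [|w s IHw]; first exact: monicX.
rewrite wcomp_rcons monicE lead_coef_comp ?size_quad //.
by rewrite (monicP IHw) (monicP (monic_quad s)) expr1n mulr1.
Qed.

(** With G the composition of [w] translated so that G(0) is its value at [s.2], the longer word is
    G(X^2) up to a translation, and both criteria for G(X^2) apply. *)
Lemma irreducible_rcons w s :
  irreducible_poly (wcomp (rcons w s)) <->
  irreducible_poly (wcomp w) /\
  forall y, y ^+ 2 != (-1) ^+ (2 ^ size w) * (wcomp w).[s.2].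
Proof.
set g := wcomp w \Po ('X - (- s.2)%:P).
have gE : wcomp (rcons w s) = (g \Po 'X^2) \Po ('X - s.1%:P).
  rewrite wcomp_rcons -!comp_polyA comp_Xn_poly comp_polyB comp_polyX comp_polyC.
  by rewrite rmorphN opprK.
have mg : g \is monic.
  by rewrite monicE lead_coef_comp ?size_XsubC // lead_coefXsubC expr1n mulr1 (monicP (monic_wcomp w)).
have sg : (size g).-1 = (2 ^ size w)%N by rewrite size_comp_poly2 ?size_XsubC // size_wcomp.
have g0 : g.[0] = (wcomp w).[s.2] by rewrite horner_comp hornerXsubC sub0r opprK.
rewrite gE irreducible_comp_XsubC -g0 -sg; split=> [irr|[irr nsq]].
  split; last by move=> y; apply/eqP => yE; apply: reducible_comp_X2 charF mg yE irr.
  by apply/(irreducible_comp_XsubC _ (- s.2))/(irreducible_comp_left _ irr); rewrite size_polyXn.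
by apply: irreducible_comp_X2 => //; apply/irreducible_comp_XsubC.
Qed.

Definition centered w : bool := all (fun s => s.1 == 0) w.

Lemma centered_word (w : seq (monic_quadratic F)) :
  exists u a, [/\ centered u, size u = size w & comp_word w = wcomp u \Po ('X - a%:P)].
Proof.
elim: w => [|f w [u [a [cu su wE]]]].
  by exists [::], 0; rewrite subr0 comp_polyXr.
have [[b c] ->] := letter_surj f.
have {}wE : comp_word (letter (b, c) :: w) = ((wcomp u \Po ('X - a%:P)) - b%:P) ^+ 2 + c%:P.
  by rewrite -wE /= comp_polyD rmorphXn /= comp_polyB comp_polyX !comp_polyC.
rewrite {}wE; case: u => [|[b' c'] u] in cu su *.
  (* No letter follows, so b joins the global shift. *)
  exists [:: (0, c)], (a + b); split; [by rewrite /= eqxx|by rewrite /= -su|].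
  rewrite wcomp_cons /= comp_polyD rmorphXn /= subr0 !comp_polyC comp_polyX.
  by rewrite (comp_polyX (_ - _)) rmorphD opprD addrA.
have /andP[/eqP /= b'0 {}cu] := cu.
(* The shift b is absorbed by the constant term of the next letter. *)
exists [:: (0, c), (0, c' - b) & u], a; split; [by rewrite /= !eqxx|by rewrite /= -su|].
rewrite !wcomp_cons /= b'0 !subr0 !comp_polyD !rmorphXn /= !comp_polyC.
by rewrite comp_polyD rmorphXn /= comp_polyC rmorphB addrA.
Qed.

Lemma size_wcomp_shift w a : size (wcomp w \Po ('X - a%:P)) = (2 ^ size w).+1.
Proof. by rewrite size_comp_poly2 ?size_XsubC // size_wcomp. Qed.

Lemma monic_wcomp_shift w a : wcomp w \Po ('X - a%:P) \is monic.
Proof.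
by rewrite monicE lead_coef_comp ?size_XsubC // lead_coefXsubC expr1n mulr1 (monicP (monic_wcomp w)).
Qed.

(** Degrees force equal lengths; then [monic_sqrDC_inj] peels off the outer letters one by one. *)
Lemma centered_word_inj u v a b : centered u -> centered v ->
  wcomp u \Po ('X - a%:P) = wcomp v \Po ('X - b%:P) -> u = v /\ a = b.
Proof.
move=> cu cv uv; have suv : size u = size v.
  have := congr1 (fun p : {poly F} => size p) uv.
  by rewrite !size_wcomp_shift => -[] /eqP; rewrite eqn_exp2l // => /eqP.
elim: u v suv cu cv uv => [|[b1 c1] u IHu] [|[b2 c2] v] //= suv.
  by move=> _ _; rewrite !comp_polyX => /addrI/oppr_inj/polyC_inj.
move=> /andP[/eqP/= -> cu] /andP[/eqP/= -> cv]; have [{}suv] := suv.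
rewrite !wcomp_cons /= !subr0 !comp_polyD !rmorphXn /= !comp_polyC.
case/(monic_sqrDC_inj two_neq0 (monic_wcomp_shift _ _) (monic_wcomp_shift _ _)).
- by rewrite !size_wcomp_shift suv.
- by rewrite size_wcomp_shift ltnS expn_gt0.
by move=> /(IHu _ suv cu cv)[-> ->] ->.
Qed.

(** A global shift can be stored in the last letter, turning a pair (word, shift) into a single
    word. *)
Lemma wcomp_shift u a c : wcomp (rcons u (0, c)) \Po ('X - a%:P) = wcomp (rcons u (a, c)).
Proof.
rewrite !wcomp_rcons -comp_polyA; congr (_ \Po _).
by rewrite /quad /= comp_polyD rmorphXn /= subr0 comp_polyX comp_polyC.
Qed.

(** Normal form for the second language: only the last letter may carry a shift. *)
Definition almost_centered w : bool := centered (take (size w).-1 w).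

(* The third component recognises the words of the second regular language; the
   flag nilp is needed since -c_1 is tested for the first letter instead of c_1. *)
Definition word_state w : bool * bool * bool * {ffun F -> F} :=
  (nilp w, centered w && irreducibleb (wcomp w),
   [&& ~~ nilp w, almost_centered w & irreducibleb (wcomp w)], [ffun x => (wcomp w).[x]]).

(** The old third flag is discarded: a shift is allowed only in the last letter, so only a centered
    prefix may be extended. *)
Definition state_step (st : bool * bool * bool * {ffun F -> F}) s :=
  let: (e, n, _, g) := st in
  let n' := n && [forall y, y ^+ 2 != (if e then - g s.2 else g s.2)] in
  (false, n' && (s.1 == 0), n', [ffun x => g (quad s).[x]]).

Lemma word_state_rcons w s : word_state (rcons w s) = state_step (word_state w) s.
Proof.
rewrite /word_state /state_step /=; set nsq := [forall y, _].
have irrE : irreducibleb (wcomp (rcons w s)) = irreducibleb (wcomp w) && nsq.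
  (* The sign (-1)^(2^k) is -1 only for k = 0, the empty prefix. *)
  have E : (if nilp w then - [ffun x => (wcomp w).[x]] s.2 else [ffun x => (wcomp w).[x]] s.2)
      = (-1) ^+ (2 ^ size w) * (wcomp w).[s.2].
    rewrite ffunE; case: (w) => [|t v] /=; first by rewrite mulN1r.
    by rewrite expnS exprM sqrrN expr1n expr1n mul1r.
  apply/irreducibleP/andP => [/irreducible_rcons[irr nsqP]|[/irreducibleP irr /forallP nsqP]].
    by split; [apply/irreducibleP|apply/forallP => y; rewrite E].
  by apply/irreducible_rcons; split=> // y; rewrite -E.
have -> : nilp (rcons w s) = false by case: (w).
rewrite /almost_centered size_rcons /= irrE.
have -> : take (size w) (rcons w s) = w by rewrite -cats1 take_size_cat.
congr (_, _, _, _).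
- by rewrite /centered all_rcons; case: (s.1 == 0); rewrite ?andbF ?andbT ?andbA.
- by rewrite andbA.
- by apply/ffunP => x; rewrite !ffunE wcomp_rcons horner_comp.
Qed.

Lemma irr_comp_centered (f : {poly F}) : irr_comp F f ->
  exists u a, [/\ ~~ nilp u, centered u, irreducibleb (wcomp u) & f = wcomp u \Po ('X - a%:P)].
Proof.
case=> _ irr [w w0 fE]; have [u [a [cu su wE]]] := centered_word w.
exists u, a; split=> //; last by rewrite fE.
  by rewrite /nilp su; case: (w) w0.
by apply/irreducibleP/(irreducible_comp_XsubC _ a); rewrite -wE -fE.
Qed.

Lemma almost_centered_rcons w s : almost_centered (rcons w s) = centered w.
Proof. by rewrite /almost_centered size_rcons -cats1 take_size_cat. Qed.

Lemma irreducible_shift_letter u a c :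
  irreducible_poly (wcomp (rcons u (a, c))) <-> irreducible_poly (wcomp (rcons u (0, c))).
Proof. by rewrite -wcomp_shift irreducible_comp_XsubC. Qed.

Lemma irr_comp_wcomp w : ~~ nilp w -> irreducibleb (wcomp w) -> irr_comp F (wcomp w).
Proof.
move=> w0 /irreducibleP irr; split=> //; first exact: monic_wcomp.
by exists (map letter w) => //; case: (w) w0.
Qed.

Lemma irr_comp_wcomp_shift w a : ~~ nilp w -> centered w -> irreducibleb (wcomp w) ->
  irr_comp F (wcomp w \Po ('X - a%:P)).
Proof.
case/lastP: w => [//|u [b c]] _; rewrite /centered all_rcons => /andP[/eqP/= -> _].
move=> /irreducibleP irr; rewrite wcomp_shift; apply: irr_comp_wcomp.
  by rewrite /nilp size_rcons.
by apply/irreducibleP/irreducible_shift_letter.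
Qed.

End Words.

(** * The partition by shifts and a single regular expression for all shifts *)

Theorem theorem3p11 (F : finFieldType) (charF : 2%N \notin [pchar F]) :
  (exists (L : set (seq (monic_quadratic F))) (La : F -> set {poly F}),
     [/\ regular L,
         classical_sets.partition [set: F] La (irr_comp F)
       & forall a : F,
           set_bij L (La a) (fun w => comp_word w \Po ('X - a%:P))])
  /\ (exists e : regexp (monic_quadratic F),
        set_bij (lang e) (irr_comp F) (@comp_word F)).
Proof.
have [nsq nsqP] : exists c : F, forall y, y ^+ 2 != c.
  by apply: exists_nonsquare; have := charF; rewrite inE.
split.
  pose good (w : seq (F * F)) := [&& ~~ nilp w, centered w & irreducibleb (wcomp w)].
  pose L := [set map (@letter F) w | w in [set w | good w]].
  exists L, (fun a => (fun w => comp_word w \Po ('X - a%:P)) @` L); split.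
  - exact: (regular_of_finite_state (@letter F)
      (fun st => ~~ st.1.1.1 && st.1.1.2) (word_state_rcons charF)).
  - split.
    + apply/seteqP; split=> [_ [a _ [_ [w /and3P[w0 cent irr] <-] <-]]|f].
        exact: irr_comp_wcomp_shift.
      case/(irr_comp_centered charF) => u [a [u0 cu irr ->]].
      exists a => //; exists (map (@letter F) u) => //.
      by exists u => //; apply/and3P.
    + move=> a b _ _ [f [[_ [u /and3P[_ cu _] <-] <-] [_ [v /and3P[_ cv _] <-]]]].
      by move=> uv; have [] := centered_word_inj charF cv cu uv.
    (* Blocks must be nonempty: X^2 - [nsq] is irreducible because -c_1 = [nsq] is a nonsquare, and
       its translate lies in the block of [a]. *)
    + move=> a _; exists (wcomp [:: (0, - nsq)] \Po ('X - a%:P)).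
      exists (map (@letter F) [:: (0, - nsq)]) => //; exists [:: (0, - nsq)] => //.
      rewrite /= /good /= eqxx /=; apply/irreducibleP.
      apply/(irreducible_rcons charF [::] (0, - nsq)); split.
        by have := irredp_XsubC (0 : F); rewrite subr0.
      by move=> y; rewrite /wcomp /= hornerX expr1 mulN1r opprK.
  move=> a; split.
  - by move=> w Lw; exists w.
  - move=> _ _ /set_mem[u /and3P[_ cu _] <-] /set_mem[v /and3P[_ cv _] <-] uv.
    by have [-> _] := centered_word_inj charF cu cv uv.
  - by [].
(* Accepting by the third flag selects the words in which only the last letter may be shifted; they
   name each irreducible composition exactly once. *)
have [e eE] := regular_of_finite_state (@letter F)
  (fun st => st.1.2) (word_state_rcons charF).
exists e; rewrite -eE; split.
- by move=> _ [w /and3P[w0 _ irr] <-]; apply: irr_comp_wcomp.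
- move=> _ _ /set_mem[u /and3P[u0 cu _] <-] /set_mem[v /and3P[v0 cv _] <-].
  case/lastP: u u0 cu => // u [a c] _; rewrite almost_centered_rcons => cu.
  case/lastP: v v0 cv => // v [b d] _; rewrite almost_centered_rcons => cv.
  (* Moving the last shifts out leaves centered words, to which uniqueness applies. *)
  rewrite -!/(wcomp _) -[LHS]wcomp_shift -[RHS]wcomp_shift => uv.
  have [||/rcons_inj[-> ->] ->] // := centered_word_inj charF _ _ uv.
    by rewrite /centered all_rcons eqxx.
  by rewrite /centered all_rcons eqxx.
move=> f fP; have [u [a [u0 cu irr ->]]] := irr_comp_centered charF fP.
case/lastP: u u0 cu irr => // u [b c] _; rewrite /centered all_rcons.
move=> /andP[/eqP/= -> cu] /irreducibleP irr.
exists (map (@letter F) (rcons u (a, c))); last by rewrite wcomp_shift.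
exists (rcons u (a, c)) => //; apply/and3P; split.
- by rewrite /nilp size_rcons.
- by rewrite almost_centered_rcons.
- by apply/irreducibleP/irreducible_shift_letter.
Qed.
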